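(* If $u=f(x,t)$ is a solution of the higher order Camassa–Holm equation $$u_t-u_{xxt}+u_{xxxxt}+3uu_x-2u_xu_{xx}-uu_{xxx}+2u_xu_{xxxx}+uu_{xxxxx}=0,$$ then, for every real $s$, so are the functions $$G_1(s)\cdot f(x,t)=f(x-s,t),\qquad G_2(s)\cdot f(x,t)=f(x,t-s),\qquad G_3(s)\cdot f(x,t)=f(x,t\,e^{-s})\,e^{-s}.$$
   Context: Here $u$ is a real-valued, sufficiently smooth function of the real variables $x$ and $t$, and subscripts denote partial derivatives. $G_i(s)\cdot f$ denotes the function obtained by letting the one-parameter transformation group $G_i$ act on the graph of $f$, where $G_1$ is $(x,t,u)\mapsto(x+s,t,u)$, $G_2$ is $(x,t,u)\mapsto(x,t+s,u)$ and $G_3$ is $(x,t,u)\mapsto(x,e^{s}t,e^{-s}u)$. If $f$ is defined only on an open subset of $\mathbb R^2$, the transformed functions are understood on the correspondingly transformed open set. *)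

(* Defs.v *)
From Stdlib Require Import Reals.
From Coquelicot Require Import Coquelicot.
Open Scope R_scope.

(* A function of (x, t) on an open set V is a total function R -> R -> R paired
   with V; its values outside V play no role. *)

Definition dx (u : R -> R -> R) : R -> R -> R :=
  fun x t => Derive (fun z => u z t) x.

Definition dt (u : R -> R -> R) : R -> R -> R :=
  fun x t => Derive (fun z => u x z) t.

(* Subscripts are read from left to right: u_xxt is dt (dx (dx u)). *)
Definition CH_lhs (u : R -> R -> R) (x t : R) : R :=
  let ux := dx u in
  let uxx := dx ux in
  let uxxx := dx uxx in
  let uxxxx := dx uxxx in
  let uxxxxx := dx uxxxx in
  dt u x t - dt uxx x t + dt uxxxx x t
  + 3 * u x t * ux x t - 2 * ux x t * uxx x t - u x t * uxxx x t
  + 2 * ux x t * uxxxx x t + u x t * uxxxxx x t.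

(* [ex_diff_n u k x t] at all points of V says that u is of class C^k on V. *)
Definition CH_solution (k : nat) (V : R * R -> Prop) (u : R -> R -> R) : Prop :=
  open V /\
  forall x t, V (x, t) -> ex_diff_n u k x t /\ CH_lhs u x t = 0.

Definition G1 (s : R) (p : R * R * R) : R * R * R :=
  let '(x, t, u) := p in (x + s, t, u).

Definition G2 (s : R) (p : R * R * R) : R * R * R :=
  let '(x, t, u) := p in (x, t + s, u).

Definition G3 (s : R) (p : R * R * R) : R * R * R :=
  let '(x, t, u) := p in (x, exp s * t, exp (- s) * u).

Definition graph (V : R * R -> Prop) (f : R -> R -> R) (p : R * R * R) : Prop :=
  let '(x, t, u) := p in V (x, t) /\ u = f x t.

(* The function h on W is the transform g . f of the function f on V: its graph
   is the image under g of the graph of f. In particular, W is the projection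
   of that image to the (x, t)-plane. *)
Definition is_transform (g : R * R * R -> R * R * R)
    (V : R * R -> Prop) (f : R -> R -> R)
    (W : R * R -> Prop) (h : R -> R -> R) : Prop :=
  forall p, graph W h p <-> exists q, graph V f q /\ p = g q.

(* Main.v *)
(* All three groups act by u(x,t) |-> c u(x - a, c t - d).  Derivatives in x only
   carry the factor c and a derivative in t carries c^2, so the linear terms, each
   with one t-derivative, and the quadratic terms, which have none, both scale by
   c^2. *)
Require Import Defs.
From Stdlib Require Import Reals Lra FunctionalExtensionality.
From Coquelicot Require Import Coquelicot.
Open Scope R_scope.

(** The time factor [b] and the amplitude [c] are kept apart so that the family is stable under
    differentiation in t, which turns [c] into [b * c]. The symmetries themselves have [b = c]. *)
Definition rescale (a b d c : R) (u : R -> R -> R) : R -> R -> R :=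
  fun x t => u (x - a) (t * b - d) * c.

Lemma locally_2d_affine (P : R -> R -> Prop) (a b d x t : R) :
  locally_2d P (x - a) (t * b - d) ->
  locally_2d (fun y z => P (y - a) (z * b - d)) x t.
Proof.
  intros [del Hdel].
  pose proof (Rabs_pos b) as Hb.
  (* The 1 in the denominator covers [b = 0] and keeps the radius at most [del], as the translated
     x-coordinate requires; the t-coordinate is stretched by [Rabs b]. *)
  assert (Hpos : 0 < del / (1 + Rabs b)).
  { apply Rdiv_lt_0_compat; [apply cond_pos | lra]. }
  exists (mkposreal _ Hpos); simpl; intros y z Hy Hz.
  assert (Hmul : del / (1 + Rabs b) * (1 + Rabs b) = del) by (field; lra).
  apply Hdel.
  - replace (y - a - (x - a)) with (y - x) by ring. nra.
  - replace (z * b - d - (t * b - d)) with ((z - t) * b) by ring.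
    rewrite Rabs_mult. pose proof (Rabs_pos (z - t)). nra.
Qed.

Lemma locally_2d_open (V : R * R -> Prop) (x t : R) :
  open V -> V (x, t) -> locally_2d (fun y z => V (y, z)) x t.
Proof.
  intros HV Hxt. apply locally_2d_locally.
  generalize (HV _ Hxt). apply filter_imp. now intros [y z].
Qed.

Lemma open_affine (V : R * R -> Prop) (a b d : R) :
  open V -> open (fun p : R * R => V (fst p - a, snd p * b - d)).
Proof.
  intros HV [x t] Hxt.
  apply (locally_2d_locally (fun y z => V (y - a, z * b - d))).
  apply (locally_2d_affine (fun y z => V (y, z))).
  now apply locally_2d_open.
Qed.

Lemma continuity_2d_pt_rescale (u : R -> R -> R) (a b d c x t : R) :
  continuity_2d_pt u (x - a) (t * b - d) ->
  continuity_2d_pt (rescale a b d c u) x t.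
Proof.
  intros Hu.
  apply (continuity_2d_pt_mult (fun y z => u (y - a) (z * b - d)) (fun _ _ => c)).
  - intros eps.
    apply (locally_2d_affine
             (fun y z => Rabs (u y z - u (x - a) (t * b - d)) < eps)).
    apply Hu.
  - apply continuity_2d_pt_const.
Qed.

(* Unlike [Derive_comp], this needs no differentiability: the difference
   quotients coincide. *)
Lemma Derive_translate (f : R -> R) (a x : R) :
  Derive (fun z => f (z - a)) x = Derive f (x - a).
Proof.
  unfold Derive. f_equal. apply Lim_ext. intros h.
  now replace (x + h - a) with (x - a + h) by ring.
Qed.

(** Translations and constant factors pass through [Derive] unconditionally, so this is an equality
    of functions and can be rewritten inside iterated derivatives. *)
Lemma dx_rescale (a b d c : R) (u : R -> R -> R) :
  dx (rescale a b d c u) = rescale a b d c (dx u).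
Proof.
  extensionality x; extensionality t. unfold dx, rescale.
  rewrite Derive_scal_l.
  now rewrite (Derive_translate (fun z => u z (t * b - d))).
Qed.

Lemma dt_rescale (a b d c x t : R) (u : R -> R -> R) :
  ex_derive (fun z => u (x - a) z) (t * b - d) ->
  dt (rescale a b d c u) x t = rescale a b d (b * c) (dt u) x t.
Proof.
  intros Hu. unfold dt, rescale. rewrite Derive_scal_l.
  rewrite (Derive_comp (fun z => u (x - a) z) (fun z => z * b - d));
    [| exact Hu | auto_derive; trivial].
  replace (Derive (fun z => z * b - d) t) with b.
  - ring.
  - symmetry. apply is_derive_unique. auto_derive; [trivial | ring].
Qed.

(** Smoothness is assumed near the point because [dt_rescale] needs differentiability in t wherever
    it is applied, and replacing the t-derivative inside [ex_diff_n] takes equality on a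
    neighbourhood. The induction generalises [c], which becomes [b * c] for that derivative. *)
Lemma ex_diff_n_rescale (n : nat) (u : R -> R -> R) (a b d c x t : R) :
  locally_2d (ex_diff_n u n) (x - a) (t * b - d) ->
  ex_diff_n (rescale a b d c u) n x t.
Proof.
  revert u c x t. induction n as [|n IH]; intros u c x t Hloc;
    pose proof (locally_2d_singleton _ _ _ Hloc) as Hu.
  - split; [apply continuity_2d_pt_rescale, Hu | trivial].
  - destruct Hu as (Hcont & Hx & Ht & _).
    repeat split.
    + now apply continuity_2d_pt_rescale.
    + apply (ex_derive_mult (fun z => u (z - a) (t * b - d)) (fun _ => c));
        [| apply ex_derive_const].
      apply (ex_derive_comp (fun z => u z (t * b - d)) (fun z => z - a));
        [exact Hx | auto_derive; trivial].
    + apply (ex_derive_mult (fun z => u (x - a) (z * b - d)) (fun _ => c));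
        [| apply ex_derive_const].
      apply (ex_derive_comp (fun z => u (x - a) z) (fun z => z * b - d));
        [exact Ht | auto_derive; trivial].
    + change (ex_diff_n (dx (rescale a b d c u)) n x t).
      rewrite dx_rescale. apply IH.
      revert Hloc. apply locally_2d_impl, locally_2d_forall.
      intros y z H. apply H.
    + change (ex_diff_n (dt (rescale a b d c u)) n x t).
      apply (ex_diff_n_ext_loc (rescale a b d (b * c) (dt u))).
      * apply locally_2d_affine in Hloc. revert Hloc.
        apply locally_2d_impl, locally_2d_forall. intros y z H.
        symmetry. apply dt_rescale, H.
      * apply IH. revert Hloc. apply locally_2d_impl, locally_2d_forall.
        intros y z H. apply H.
Qed.

Lemma CH_lhs_rescale (a c d x t : R) (u : R -> R -> R) :
  ex_diff_n u 5 (x - a) (t * c - d) ->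
  CH_lhs (rescale a c d c u) x t = c * c * CH_lhs u (x - a) (t * c - d).
Proof.
  (* Descending along the x-derivatives, the pattern keeps the t-differentiability of u, u_xx and
     u_xxxx; reaching the last one uses order 5. *)
  intros (_ & _ & Ht & (_ & _ & _ & (_ & _ & Hxxt & (_ & _ & _ &
    (_ & _ & Hxxxxt & _) & _) & _) & _) & _).
  unfold CH_lhs. rewrite !dx_rescale, !dt_rescale by assumption.
  unfold rescale. ring.
Qed.

Lemma CH_solution_rescale (k : nat) (V : R * R -> Prop) (u : R -> R -> R)
    (a c d : R) :
  (5 <= k)%nat -> CH_solution k V u ->
  CH_solution k (fun p => V (fst p - a, snd p * c - d)) (rescale a c d c u).
Proof.
  intros Hk [HV Hu]. split; [now apply open_affine |].
  simpl. intros x t Hxt. destruct (Hu _ _ Hxt) as [Hdiff Heq]. split.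
  (* Openness of [V] turns regularity at each point into regularity on a neighbourhood. *)
  - apply ex_diff_n_rescale. generalize (locally_2d_open _ _ _ HV Hxt).
    apply locally_2d_impl, locally_2d_forall. intros y z Hyz. now apply Hu.
  - rewrite CH_lhs_rescale, Heq; [ring | now apply (ex_diff_n_m k)].
Qed.

Lemma CH_solution_ext (k : nat) (V W : R * R -> Prop) (u v : R -> R -> R) :
  (forall p, V p = W p) -> (forall x t, u x t = v x t) ->
  CH_solution k V u -> CH_solution k W v.
Proof.
  intros HVW Huv.
  replace W with V by now apply functional_extensionality.
  replace v with u by (extensionality x; extensionality t; apply Huv).
  trivial.
Qed.

Theorem theorem3p1 (k : nat) (hk : (5 <= k)%nat)
    (V : R * R -> Prop) (f : R -> R -> R) (hf : CH_solution k V f) (s : R) :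
  let V1 := fun p : R * R => V (fst p - s, snd p) in
  let V2 := fun p : R * R => V (fst p, snd p - s) in
  let V3 := fun p : R * R => V (fst p, snd p * exp (- s)) in
  let f1 := fun x t : R => f (x - s) t in
  let f2 := fun x t : R => f x (t - s) in
  let f3 := fun x t : R => f x (t * exp (- s)) * exp (- s) in
  (is_transform (G1 s) V f V1 f1 /\ CH_solution k V1 f1) /\
  (is_transform (G2 s) V f V2 f2 /\ CH_solution k V2 f2) /\
  (is_transform (G3 s) V f V3 f3 /\ CH_solution k V3 f3).
Proof.
  intros V1 V2 V3 f1 f2 f3.
  assert (He : exp s * exp (- s) = 1).
  { rewrite <- exp_plus, Rplus_opp_r. apply exp_0. }
  split; [| split]; split.
  - intros [[x t] w]; split.
    (* The witness is the preimage under the inverse transformation [G1 (- s)]. *)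
    + intros [HV ->]. exists (x - s, t, f1 x t). repeat split; trivial.
      simpl. repeat f_equal. ring.
    + intros [[[y z] v] [[HV ->] [= -> -> ->]]]. unfold graph, V1, f1; simpl.
      replace (y + s - s) with y by ring. now split.
  - apply CH_solution_ext with (3 := CH_solution_rescale k V f s 1 0 hk hf).
    + intros p. unfold V1. repeat f_equal. ring.
    + intros x t. unfold rescale, f1. rewrite !Rmult_1_r. repeat f_equal. ring.
  - intros [[x t] w]; split.
    + intros [HV ->]. exists (x, t - s, f2 x t). repeat split; trivial.
      simpl. repeat f_equal. ring.
    + intros [[[y z] v] [[HV ->] [= -> -> ->]]]. unfold graph, V2, f2; simpl.
      replace (z + s - s) with z by ring. now split.
  - apply CH_solution_ext with (3 := CH_solution_rescale k V f 0 1 s hk hf).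
    + intros p. unfold V2. repeat f_equal; ring.
    + intros x t. unfold rescale, f2. rewrite !Rmult_1_r. repeat f_equal. ring.
  - intros [[x t] w]; split.
    (* Again the preimage, now under [G3 s]: its last entry is the value of [f] before scaling by
       [exp (- s)]. *)
    + intros [HV ->]. exists (x, t * exp (- s), f x (t * exp (- s))).
      repeat split; trivial.
      simpl. unfold f3. f_equal; [f_equal |]; [| ring].
      transitivity (t * (exp s * exp (- s))); [rewrite He |]; ring.
    + intros [[[y z] v] [[HV ->] [= -> -> ->]]]. unfold graph, V3, f3; simpl.
      replace (exp s * z * exp (- s)) with z.
      * split; [exact HV | ring].
      * transitivity (z * (exp s * exp (- s))); [rewrite He |]; ring.
  (* Here [exp (- s)] is both the time factor and the amplitude, as [CH_solution_rescale]
     demands. *)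
  - apply CH_solution_ext with
      (3 := CH_solution_rescale k V f 0 (exp (- s)) 0 hk hf).
    + intros p. unfold V3. now rewrite !Rminus_0_r.
    + intros x t. unfold rescale, f3. now rewrite !Rminus_0_r.
Qed.
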